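(* There are two primitive injective substitutions $\eta$ and $\zeta$ on a three letter alphabet $\{a,b,c\}$ that generate dynamical systems topologically isomorphic to the Fibonacci system $(X_\varphi,\sigma)$. These are given by $$\eta(a)=b,\ \eta(b)=ca,\ \eta(c)=ba,\qquad \zeta(a)=b,\ \zeta(b)=ac,\ \zeta(c)=ab.$$
   Context: A substitution $\theta$ on a finite alphabet $A$ is a map from $A$ to non-empty finite words over $A$, extended to words and sequences by concatenation. $\theta$ is primitive if for some $k\ge1$ every letter of $A$ occurs in $\theta^k(a)$ for all $a\in A$; it is injective if $\theta(a)\ne\theta(b)$ for all letters $a\neq b$ of $A$. For primitive $\theta$, the dynamical system generated by $\theta$ is $(X_\theta,\sigma)$, where $X_\theta\subset A^{\mathbb Z}$ is the set of two-sided sequences all of whose finite subwords occur in some $\theta^k(a)$, $k\ge1$, $a\in A$, and $\sigma$ is the shift map. The Fibonacci substitution is $\varphi:0\mapsto 01,\ 1\mapsto 0$, and the Fibonacci system is $(X_\varphi,\sigma)$. Two subshifts $(X,\sigma)$ and $(Y,\sigma)$ are topologically isomorphic if there is a homeomorphism $\psi:X\to Y$ with $\psi\sigma=\sigma\psi$.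
   Formalization: ''Two'' is read as exactly two, counted up to renaming letters and among substitutions whose Perron–Frobenius eigenvalue is the golden mean; without this it fails, since η² (a→ca, b→bab, c→cab) is another such substitution. That η and ζ qualify is stated without added hypotheses. *)

(* Defs.v *)
From HB Require Import structures.
From mathcomp Require Import all_boot all_order all_algebra all_fingroup all_field.
From mathcomp Require Import all_classical topology.

Set Implicit Arguments.
Unset Strict Implicit.
Unset Printing Implicit Defensive.

Import GRing.Theory Num.Theory.

Local Open Scope classical_set_scope.
Local Open Scope ring_scope.

Section Substitutions.
Variable A : finType.
Implicit Types (theta : A -> seq A) (w : seq A).

Definition is_substitution theta : Prop := forall a, theta a != [::].

Definition subst_word theta w : seq A := flatten [seq theta a | a <- w].

Definition subst_iter theta (k : nat) (a : A) : seq A :=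
  iter k (subst_word theta) [:: a].

Definition is_primitive theta : Prop :=
  exists2 k : nat, (0 < k)%N & forall a b : A, b \in subst_iter theta k a.

End Substitutions.

Definition biseq (A : finType) : topologicalType :=
  prod_topology (fun _ : int => discrete_topology A).

Definition shift_map (A : finType) (x : biseq A) : biseq A := fun i => x (i + 1).

Definition subword (A : finType) (x : biseq A) (i : int) (n : nat) : seq A :=
  mkseq (fun j : nat => x (i + j%:Z)) n.

Definition subst_system (A : finType) (theta : A -> seq A) : set (biseq A) :=
  [set x | forall (i : int) (n : nat),
     exists (k : nat) (a : A),
       (0 < k)%N /\ infix (subword x i n) (subst_iter theta k a)].

(* The subshifts are subsets of the full shifts; psi and its inverse phi are
   only constrained there, and continuity is for the subspace topologies. *)
Definition topologically_isomorphic (A B : finType)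
    (X : set (biseq A)) (Y : set (biseq B)) : Prop :=
  exists (psi : biseq A -> biseq B) (phi : biseq B -> biseq A),
    [/\ (forall x, X x -> Y (psi x) /\ phi (psi x) = x),
        (forall y, Y y -> X (phi y) /\ psi (phi y) = y),
        {within X, continuous psi},
        {within Y, continuous phi}
      & forall x, X x -> psi (shift_map x) = shift_map (psi x)].

(* Entry (i, j) counts the occurrences of the letter i in theta(j). *)
Definition incidence_mx (n : nat) (theta : 'I_n -> seq 'I_n) : 'M[algC]_n :=
  \matrix_(i < n, j < n) (count_mem i (theta j))%:R.

Definition is_PF_eigenvalue (n : nat) (M : 'M[algC]_n) (lambda : algC) : Prop :=
  eigenvalue M lambda /\
  forall mu : algC, eigenvalue M mu -> mu != lambda -> `|mu| < lambda.

Definition golden_mean : algC := (1 + sqrtC 5%:R) / 2%:R.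

Definition same_up_to_renaming (A : finType) (theta theta' : A -> seq A) : Prop :=
  exists pi : {perm A}, forall a, theta' (pi a) = [seq pi x | x <- theta a].

Definition fibonacci (x : 'I_2) : seq 'I_2 :=
  if x == ord0 then [:: ord0; ord_max] else [:: ord0].

Definition letter_a : 'I_3 := @Ordinal 3 0 isT.
Definition letter_b : 'I_3 := @Ordinal 3 1 isT.
Definition letter_c : 'I_3 := @Ordinal 3 2 isT.

Definition subst_eta (x : 'I_3) : seq 'I_3 :=
  if x == letter_a then [:: letter_b]
  else if x == letter_b then [:: letter_c; letter_a]
  else [:: letter_b; letter_a].

Definition subst_zeta (x : 'I_3) : seq 'I_3 :=
  if x == letter_a then [:: letter_b]
  else if x == letter_b then [:: letter_a; letter_c]
  else [:: letter_a; letter_b].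

Definition in_fibonacci_class (A : finType) (theta : A -> seq A) : Prop :=
  [/\ is_substitution theta, is_primitive theta, injective theta
    & topologically_isomorphic (subst_system theta) (subst_system fibonacci)].

(* Main.v *)
(** By compactness a conjugacy onto the Fibonacci system is inverted by a
    block code of some radius r, so words of length n inject into Fibonacci
    words of length n + 2r, of which there are only n + 2r + 1 for infinitely
    many n. If the golden mean is the Perron-Frobenius eigenvalue of a 3x3
    incidence matrix, then its characteristic polynomial is (x^2 - x - 1)(x -
    m) with m in {-1, 0, 1}, which leaves nine injective primitive
    substitutions up to renaming. Six of them have, for every n, a word of
    length n extendable by all three letters on the same side, hence at least
    2n + 1 words of length n. In the system of a -> b, b -> aca, c -> a the
    letter a occurs at every second place, whereas in the Fibonacci system
    arbitrarily long words return after an odd time. The remaining two are eta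
    and zeta: sending a to 1 and b, c to 0 intertwines eta with phi and zeta
    with the mirror image of phi, and this factor map is inverted by a two-
    block code. *)

Require Import Defs.
From mathcomp Require Import all_boot all_order all_algebra all_fingroup all_field.
From mathcomp Require Import all_classical topology.
From mathcomp Require Import zify ring.

Set Implicit Arguments.
Unset Strict Implicit.
Unset Printing Implicit Defensive.

Import Order.TTheory GRing.Theory Num.Theory.

(** * Language of a substitution *)

Section Language.
Variable A : finType.
Implicit Types (theta : A -> seq A) (u v w : seq A).

Definition lang theta w : Prop :=
  exists (k : nat) (a : A), 0 < k /\ infix w (subst_iter theta k a).

Lemma subst_word_cat theta u v :
  subst_word theta (u ++ v) = subst_word theta u ++ subst_word theta v.
Proof. by rewrite /subst_word map_cat flatten_cat. Qed.

Lemma iter_subst_word_cat theta k u v :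
  iter k (subst_word theta) (u ++ v) =
  iter k (subst_word theta) u ++ iter k (subst_word theta) v.
Proof. by elim: k => //= k ->; rewrite subst_word_cat. Qed.

Lemma iter_subst_word_nil theta k : iter k (subst_word theta) [::] = [::].
Proof. by elim: k => //= k ->. Qed.

Lemma subst_iterD theta k l a :
  subst_iter theta (k + l) a = iter k (subst_word theta) (subst_iter theta l a).
Proof. by rewrite /subst_iter iterD. Qed.

Lemma subst_word1 theta a : subst_word theta [:: a] = theta a.
Proof. by rewrite /subst_word /= cats0. Qed.

Lemma infix_iter_subst_word theta k u v :
  infix u v -> infix (iter k (subst_word theta) u) (iter k (subst_word theta) v).
Proof.
case/infixP=> p [s ->]; apply/infixP.
exists (iter k (subst_word theta) p), (iter k (subst_word theta) s).
by rewrite !iter_subst_word_cat.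
Qed.

Lemma lang_infix theta u v : infix u v -> lang theta v -> lang theta u.
Proof.
by move=> uv [k [a [k0 va]]]; exists k, a; split=> //; apply: infix_trans va.
Qed.

Lemma lang_iter theta k w : lang theta w -> lang theta (iter k (subst_word theta) w).
Proof.
move=> [l [a [l0 wa]]]; exists (k + l), a; split; first by rewrite addn_gt0 l0 orbT.
by rewrite subst_iterD infix_iter_subst_word.
Qed.

Lemma iter_subst_word_eq0 theta : is_substitution theta ->
  forall k w, (iter k (subst_word theta) w == [::]) = (w == [::]).
Proof.
move=> ne; elim=> // k IH w; rewrite iterSr IH; case: w => //= a w.
by rewrite /subst_word /=; case: (theta a) (ne a).
Qed.

(** No iterate of a letter is empty, since emptiness would persist while some theta^k of every
    letter contains all letters. Applying that theta^k to the non-empty theta^(l-k)(a) gives the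
    claim. *)
Lemma is_primitive_all theta : is_primitive theta ->
  exists2 k, 0 < k & forall l a b, k <= l -> b \in subst_iter theta l a.
Proof.
move=> [k k0 prim]; exists k => // l a b /subnK <-.
rewrite addnC subst_iterD.
have: subst_iter theta (l - k) a != [::].
  elim: (l - k) => //= n; case: (subst_iter theta n a) => // c w _.
  have : b \in iter k (subst_word theta) (c :: w).
    by rewrite -cat1s iter_subst_word_cat mem_cat prim.
  rewrite /subst_iter in prim.
  apply: contraL => /eqP E.
  case: (k) k0 prim => // m _; rewrite iterSr E => _.
  by rewrite iter_subst_word_nil.
case: (subst_iter theta (l - k) a) => // c w _.
by rewrite -cat1s iter_subst_word_cat mem_cat prim.
Qed.

(** Two distinct letters occur in theta^k(a), so it has length at least two. Then theta^(2k)(a)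
    holds a copy of [a] with letters to its right and a copy with letters to its left. *)
Lemma is_primitive_two theta : 1 < #|A| -> is_primitive theta ->
  exists k, forall a, exists d1 d2 t,
    [/\ subst_iter theta k a = d1 :: d2 :: t, a \in subst_iter theta k d1
      & a \in subst_iter theta k d2].
Proof.
move=> cA /is_primitive_all [k k0 prim]; exists k => a.
have [b ab] : exists b, a != b.
  move: cA; rewrite (cardD1 a) inE /= => /card_gt0P [b].
  by rewrite !inE eq_sym => /andP [ba _]; exists b.
have := prim k a a (leqnn k); have := prim k a b (leqnn k).
case: (subst_iter theta k a) => [|d1 [|d2 t]] //; last first.
  by move=> _ _; exists d1, d2, t; split=> //; apply: prim.
by rewrite !inE => /eqP E1 /eqP E2; rewrite E1 E2 eqxx in ab.
Qed.

Lemma mem_split a w : a \in w -> exists p s : seq A, w = p ++ a :: s.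
Proof. by case/path.splitPr => p s; exists p, s. Qed.

(** A word [w] inside theta^l(a) recurs in theta^(l+2k)(a), within the image of the copy of [a] in
    theta^k(d1). The non-empty image of theta^k(d2) follows it, so [w] is not final there. *)
Lemma lang_extendr theta w : 1 < #|A| -> is_substitution theta ->
  is_primitive theta -> lang theta w -> exists b, lang theta (rcons w b).
Proof.
move=> cA ne /(is_primitive_two cA) [k prim] [l [a [l0 /infixP [p [s E]]]]].
have [d1 [d2 [t [E1 /mem_split [p' [s' E2]] _]]]] := prim a.
have : s ++ iter l (subst_word theta) (s' ++ iter k (subst_word theta) (d2 :: t)) != [::].
  have: iter l (subst_word theta) (s' ++ iter k (subst_word theta) (d2 :: t)) != [::].
    rewrite iter_subst_word_eq0 //; move: (iter_subst_word_eq0 ne k (d2 :: t)).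
    by case: (iter k _ _) => // ?? _; case: (s').
  by case: (iter l _ _) => // ?? _; case: (s).
case Er : (s ++ _) => [|b r] // _; exists b, (l + (k + k)), a.
split; first by rewrite addn_gt0 l0.
rewrite !subst_iterD E1 -cat1s iter_subst_word_cat -/(subst_iter theta k d1) E2.
rewrite -cat1s -!catA !iter_subst_word_cat -/(subst_iter theta l a) E.
rewrite -iter_subst_word_cat -!catA Er -[b :: r]cat1s (catA w) cats1.
by rewrite infix_catl // infix_infix.
Qed.

Lemma lang_extendl theta w : 1 < #|A| -> is_substitution theta ->
  is_primitive theta -> lang theta w -> exists b, lang theta (b :: w).
Proof.
move=> cA ne /(is_primitive_two cA) [k prim] [l [a [l0 /infixP [p [s E]]]]].
have [d1 [d2 [t [E1 _ /mem_split [p' [s' E2]]]]]] := prim a.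
have : iter l (subst_word theta) (iter k (subst_word theta) [:: d1] ++ p') ++ p != [::].
  have: iter l (subst_word theta) (iter k (subst_word theta) [:: d1] ++ p') != [::].
    rewrite iter_subst_word_eq0 //; move: (iter_subst_word_eq0 ne k [:: d1]).
    by case: (iter k _ _).
  by case: (iter l _ _).
case/lastP Er : (_ ++ _) => [|r b] // _; exists b, (l + (k + k)), a.
split; first by rewrite addn_gt0 l0.
rewrite !subst_iterD E1 -[d1 :: _]cat1s -[d2 :: t]cat1s !iter_subst_word_cat.
rewrite -![iter k _ [:: d2]]/(subst_iter theta k d2) E2 -[a :: s']cat1s.
rewrite !iter_subst_word_cat -/(subst_iter theta l a) E.
rewrite -!catA !(catA (iter l _ (iter k _ [:: d1]))) -iter_subst_word_cat.
rewrite (catA _ p) Er cat_rcons -cat_cons.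
by rewrite infix_catl // infix_catr // infix_refl.
Qed.
End Language.

(** * Points of the subshift and their shifts *)

Section Points.
Local Open Scope ring_scope.
Local Open Scope classical_set_scope.
Variable A : finType.
Implicit Types (theta : A -> seq A) (x : biseq A).

Definition shiftz (i : int) x : biseq A := fun j => x (j + i).

Lemma size_subword x i n : size (subword x i n) = n.
Proof. exact: size_mkseq. Qed.

Lemma shiftz0 x : shiftz 0 x = x.
Proof. by apply/funext => k; rewrite /shiftz addr0. Qed.

Lemma subword_shiftz x i j n : subword (shiftz i x) j n = subword x (j + i) n.
Proof. by apply: eq_mkseq => k; rewrite /shiftz addrAC. Qed.

Lemma subst_system_shiftz theta x i :
  subst_system theta x -> subst_system theta (shiftz i x).
Proof. by move=> Xx j n; rewrite subword_shiftz; apply: Xx. Qed.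

Lemma infix_nth (a0 : A) (w u : seq A) p : (p + size w <= size u)%N ->
  (forall j, (j < size w)%N -> nth a0 w j = nth a0 u (p + j)) -> infix w u.
Proof.
move=> le_u eq_nth; have -> : w = take (size w) (drop p u).
  apply: (@eq_from_nth _ a0) => [|j jw]; first by rewrite size_takel // size_drop; lia.
  by rewrite nth_take // nth_drop eq_nth.
by apply/infixP; exists (take p u), (drop (size w) (drop p u)); rewrite !cat_take_drop.
Qed.

(** The word is extended by one letter on each side again and again, and the nested words [W n]
    converge to a two-sided sequence. *)
Lemma lang_point theta w i : (1 < #|A|)%N -> is_substitution theta ->
  is_primitive theta -> lang theta w ->
  exists2 x, subst_system theta x & subword x i (size w) = w.
Proof.
move=> cA ne prim Lw.
have [a0 _] : exists a0 : A, a0 \in A by apply/card_gt0P; apply: ltnW cA.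
have ext (v : {v | lang theta v}) : exists u : {v | lang theta v},
    exists a b, sval u = a :: rcons (sval v) b.
  case: v => v Lv /=; have [b Lb] := lang_extendr cA ne prim Lv.
  by have [a La] := lang_extendl cA ne prim Lb; exists (exist _ _ La), a, b.
have [F F_ext] := choice ext.
pose W n := sval (iter n F (exist _ w Lw)).
have LW n : lang theta (W n) by exact: svalP.
have sizeW n : size (W n) = (size w + n.*2)%N.
  elim: n => [|n IH]; first by rewrite addn0.
  by rewrite /W /=; have [a [b ->]] := F_ext (iter n F (exist _ w Lw));
    rewrite /= size_rcons IH; lia.
have nthW n j : (j < size (W n))%N -> nth a0 (W n.+1) j.+1 = nth a0 (W n) j.
  by move=> jW; rewrite /W /=; have [a [b ->]] := F_ext (iter n F (exist _ w Lw));
    rewrite /= nth_rcons jW.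
(* Each extension adds one letter on the left, so position [z] has index z + n in [W n]. At stage
   |z| + 1 this index is in range, and the default [a0] is never read. *)
pose x : biseq A := fun z => nth a0 (W (absz z).+1) (absz (z + (absz z).+1%:Z)).
have xE z m : (absz z < m)%N -> x z = nth a0 (W m) (absz (z + m%:Z)).
  elim: m => // m IH; rewrite ltnS leq_eqVlt => /predU1P [<- //|zm].
  rewrite (IH zm) -nthW; last by rewrite sizeW; lia.
  by congr nth; lia.
have Xx : subst_system theta x.
  move=> j n; apply: (@lang_infix _ theta _ (W (absz j + n).+1)) => //.
  apply: (@infix_nth a0 _ _ (absz (j + (absz j + n).+1%:Z))); rewrite size_mkseq.
    by rewrite sizeW; lia.
  move=> k kn; rewrite nth_mkseq // (xE _ (absz j + n).+1); last by lia.
  by congr nth; lia.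
exists (shiftz (- i) x); first exact: subst_system_shiftz.
rewrite subword_shiftz subrr.
have W0 n k : (k < size w)%N -> nth a0 (W n) (k + n) = nth a0 w k.
  by move=> kw; elim: n => [|n IH]; rewrite ?addn0 // addnS nthW ?sizeW //; lia.
apply: (@eq_from_nth _ a0) => [|k]; rewrite size_mkseq // => kw.
rewrite nth_mkseq // add0r (xE _ k.+1); last by lia.
by rewrite -[RHS](W0 k.+1) //; congr nth; lia.
Qed.

End Points.

(** * Topology of the full shift *)

Section Topology.
Local Open Scope classical_set_scope.

Definition agree (A : finType) (r : nat) (x y : biseq A) : Prop :=
  forall j : int, (absz j <= r)%N -> x j = y j.

Lemma agreeW (A : finType) r s (x y : biseq A) : (r <= s)%N -> agree s x y -> agree r x y.
Proof. by move=> rs xy j jr; apply: xy; apply: leq_trans rs. Qed.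

(** The product topology is the supremum of the topologies induced by the coordinates, and
    convergence in a discrete factor means being eventually equal to the limit. *)
Lemma cvg_biseq (A : finType) (x : biseq A) (F : set_system (biseq A)) :
  Filter F -> (forall i, F [set y | y i = x i]) -> F --> x.
Proof.
move=> FF Fx.
have [_] := @cvg_sup (int -> discrete_topology A) int (fun i => Topological.class
  (initial_topology (fun f : int -> discrete_topology A => f i))) F x FF.
apply=> i.
have sT : (fun y : int -> discrete_topology A => y i) @` setT = setT.
  by rewrite eqEsubset; split=> // a _; exists (fun=> a).
have [_] := @cvg_image _ (discrete_topology A) _ F x FF sT; apply.
rewrite nbhs_principalE => Q /principal_filterP Qx.
exists ((fun y : int -> discrete_topology A => y i) @^-1` Q).
  by apply: filterS (Fx i) => y /= ->.
exact: image_preimage.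
Qed.

(** In one direction the filter generated by the cylinders around [x] converges to [x]; in the other
    a cylinder is a finite intersection of open coordinate conditions, added two at a time. *)
Lemma nbhs_biseqP (A : finType) (x : biseq A) (P : set (biseq A)) :
  nbhs x P <-> exists r, forall y, agree r x y -> P y.
Proof.
split.
  pose F : set_system (biseq A) :=
    [set Q | exists r, forall y, agree r x y -> Q y].
  have FF : Filter F.
    split; first by exists 0%N.
      move=> Q R [r Qr] [s Rs]; exists (maxn r s) => y xy; split.
        by apply: Qr; apply: agreeW xy; rewrite leq_maxl.
      by apply: Rs; apply: agreeW xy; rewrite leq_maxr.
    by move=> Q R QR [r Qr]; exists r => y /Qr /QR.
  suff Fx : F --> x by move=> Px; exact: Fx Px.
  by apply: cvg_biseq => i; exists (absz i) => y xy /=; rewrite -xy.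
have xi (i : int) : nbhs x [set y | x i = y i].
  have xi : nbhs x ((fun y : biseq A => y i) @^-1` [set x i]).
    exact: (@proj_continuous int (fun=> discrete_topology A) i x [set x i]
      (@discrete_set1 (discrete_topology A) _)).
  by apply: filterS xi => y /= ->.
case=> r; move: P; elim: r => [|r IH] P Pr.
  apply: filterS (xi (Posz 0)) => y /= xy; apply: Pr => j.
  by rewrite leqn0 absz_eq0 => /eqP ->.
have xr : nbhs x [set y | agree r x y] by apply: IH.
apply: filterS (filterI xr (filterI (xi (Posz r.+1)) (xi (- Posz r.+1)%R))).
move=> y [xy [xp xn]]; apply: Pr => j; rewrite leq_eqVlt ltnS => /predU1P [jr|]; last exact: xy.
by have [->|->] : j = Posz r.+1 \/ j = (- Posz r.+1)%R by lia.
Qed.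


Lemma eq_subword (A : finType) (x y : biseq A) i n :
  agree (absz i + n) x y -> subword x i n = subword y i n.
Proof.
move=> xy; apply: (@eq_from_nth _ (x i)); rewrite !size_mkseq // => j jn.
by rewrite !nth_mkseq // xy //; lia.
Qed.

(** The full shift is compact by Tychonoff, and the subshift is closed because membership is a
    condition on finite windows. *)
Lemma compact_subst_system (A : finType) (theta : A -> seq A) :
  compact (subst_system theta).
Proof.
have cT : compact [set x : biseq A | forall i : int, (setT : set (discrete_topology A)) (x i)].
  apply: (@tychonoff int (fun=> discrete_topology A) (fun=> setT)) => _.
  by apply: finite_compact; exact: finite_finset.
apply: subclosed_compact cT _ => // x clx i n.
have [y [Xy xy]] : (subst_system theta `&` [set y | agree (absz i + n) x y]) !=set0.
  by apply: clx; apply/nbhs_biseqP; exists (absz i + n)%N.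
by rewrite (eq_subword xy); exact: Xy.
Qed.

Lemma within_continuous_agree (A B : finType) (X : set (biseq A)) (f : biseq A -> biseq B) :
  {within X, continuous f} -> forall x r, X x ->
  exists s, forall y, X y -> agree s x y -> agree r (f x) (f y).
Proof.
move=> /subspace_continuousP fX x r Xx.
have /(fX x Xx) : nbhs (f x) [set z | agree r (f x) z] by apply/nbhs_biseqP; exists r.
by move=> /nbhs_biseqP [s sP]; exists s => y Xy xy; exact: sP.
Qed.

(** Uniform continuity: near each point continuity gives a radius that also serves the neighbouring
    points, and compactness yields one radius for all. *)
Lemma subst_system_window (A B : finType) (theta : A -> seq A) (f : biseq A -> biseq B) :
  {within subst_system theta, continuous f} ->
  exists r, forall x y, subst_system theta x -> subst_system theta y ->
    agree r x y -> f x (Posz 0) = f y (Posz 0).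
Proof.
move=> /within_continuous_agree cf.
have /compact_near_coveringP near_cover := @compact_subst_system A theta.
have /near_cover : forall x, subst_system theta x ->
    \forall x' \near x & r \near \oo, forall y, subst_system theta x' ->
      subst_system theta y -> agree r x' y -> f x' (Posz 0) = f y (Posz 0).
  move=> x Xx; have [s sP] := cf x 0%N Xx.
  exists ([set x' | agree s x x'], [set r | (s <= r)%N]) => /=.
    by split; [apply/nbhs_biseqP; exists s | exists s].
  move=> [x' r] /= [xx' sr] y Xx' Xy x'y.
  rewrite -(sP x' Xx' xx') // -(sP y Xy) // => j js.
  by rewrite xx' // x'y // (leq_trans js).
by case=> r _ rP; exists r => x y Xx Xy; apply: (rP r (leqnn r) x Xx).
Qed.

Lemma local_continuous (A B : finType) (f : biseq A -> biseq B) :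
  (forall x y i, agree (absz i).+1 x y -> f x i = f y i) -> continuous f.
Proof.
move=> floc x P /nbhs_biseqP [r rP]; apply/nbhs_biseqP; exists r.+1 => y xy.
by apply: rP => j jr; apply: floc; apply: agreeW xy; rewrite ltnS.
Qed.

End Topology.

(** * Conjugacy of subshifts *)

Section Conjugacy.
Local Open Scope ring_scope.
Local Open Scope classical_set_scope.
Variables (A B : finType) (theta : A -> seq A) (tau : B -> seq B).

(** The Curtis-Hedlund-Lyndon theorem for the inverse map: a window determines the value at 0, and
    commutation with shifts carries this to every position. *)
Lemma conjugacy_block_code :
  topologically_isomorphic (subst_system theta) (subst_system tau) ->
  exists (phi : biseq B -> biseq A) (r : nat),
  [/\ forall y, subst_system tau y -> subst_system theta (phi y),
      forall x, subst_system theta x ->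
        exists2 y, subst_system tau y & x = phi y
    & forall y z i j, subst_system tau y -> subst_system tau z ->
        (forall k, (absz k <= r)%N -> y (i + k) = z (j + k)) ->
        phi y i = phi z j].
Proof.
move=> [psi [phi [psiK phiK _ /subst_system_window [r rP] shP]]].
(* Commutation with the shift is given for [psi] only; its inverse inherits it, first for forward
   shifts. *)
have shN y (n : nat) : subst_system tau y -> phi (shiftz n y) = shiftz n (phi y).
  move=> Yy; elim: n => [|n IH].
    by rewrite !shiftz0.
  have Xn : subst_system theta (shiftz n (phi y)).
    by apply: subst_system_shiftz; have [] := phiK _ Yy.
  have := shP _ Xn; rewrite -IH.
  have [_ ->] := phiK _ (@subst_system_shiftz _ _ _ n Yy) => E.
  have -> : shiftz n.+1 y = shift_map (shiftz n y).
    by apply/funext => k; rewrite /shiftz /shift_map; congr y; lia.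
  rewrite -E IH; have [_ ->] := psiK _ (@subst_system_shiftz _ _ _ 1 Xn).
  by apply/funext => k; rewrite /shiftz /shift_map; congr (phi y); lia.
have shZ y i : subst_system tau y -> phi (shiftz i y) = shiftz i (phi y).
  move=> Yy; case: i => n; first exact: shN.
  (* A backward shift is undone by a forward one, to which the previous case applies. *)
  have := shN (shiftz (Negz n) y) n.+1 (subst_system_shiftz _ Yy).
  have -> : shiftz n.+1 (shiftz (Negz n) y) = y.
    by apply/funext => k; rewrite /shiftz; congr y; lia.
  by move=> ->; apply/funext => k; rewrite /shiftz; congr (phi _); lia.
exists phi, r; split=> [y /phiK []//|x /psiK [Yx xE]|y z i j Yy Yz yz].
  by exists (psi x).
have := rP (shiftz i y) (shiftz j z) (subst_system_shiftz _ Yy) (subst_system_shiftz _ Yz).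
rewrite !shZ // /shiftz !add0r; apply => k kr.
by rewrite ![k + _]addrC yz.
Qed.

Lemma conjugacy_words : (1 < #|A|)%N -> is_substitution theta -> is_primitive theta ->
  topologically_isomorphic (subst_system theta) (subst_system tau) ->
  exists r, forall n (s : seq (seq A)), uniq s ->
    (forall w, w \in s -> size w = n /\ lang theta w) ->
  exists s' : seq (seq B), [/\ uniq s', size s' = size s
    & forall v, v \in s' -> size v = (n + r.*2)%N /\ lang tau v].
Proof.
move=> cA ne prim /conjugacy_block_code [phi [r [_ phi_onto phi_loc]]].
exists r => n s us sP.
(* Reading [w] from position [r] of [phi y] keeps the windows of radius [r] around its letters
   within the first |w| + 2r letters of [y], so [v] determines [w]. Words outside the language get a
   dummy value. *)
have lift (w : seq A) : exists v : seq B, lang theta w -> exists y,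
    [/\ subst_system tau y, v = subword y 0 (size w + r.*2)
      & w = subword (phi y) r (size w)].
  have [Lw|nL] := pselect (lang theta w); last by exists [::].
  have [x Xx xw] := lang_point r cA ne prim Lw.
  have [y Yy xy] := phi_onto x Xx.
  by exists (subword y 0 (size w + r.*2)) => _; exists y; rewrite -xy xw.
have [f fP] := choice lift; exists [seq f w | w <- s]; split.
- rewrite map_inj_in_uniq // => w w' /sP [wn /fP [y [Yy -> ->]]] /sP [w'n /fP [z [Yz -> ->]]].
  rewrite wn w'n => yz; apply/eq_in_map => k; rewrite mem_iota => /andP [_ kn].
  apply: phi_loc => // l lr; have [a0 _] : exists a0 : B, a0 \in B by exists (y 0).
  have := congr1 (nth a0 ^~ (absz (r%:Z + k%:Z + l))) yz.
  rewrite !nth_mkseq ?size_subword; [|lia..].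
  have -> : (absz (r%:Z + k%:Z + l))%:Z = r%:Z + k%:Z + l by lia.
  by rewrite !add0r => ->.
- by rewrite size_map.
- move=> v /mapP [w /sP [wn Lw] ->]; have [y [Yy -> _]] := fP w Lw.
  by rewrite size_subword wn; split=> //; apply: Yy.
Qed.

End Conjugacy.

(** * Counting words *)

Section Growth.
Variables (A : finType) (theta : A -> seq A).
Hypotheses (cA : 1 < #|A|) (ne : is_substitution theta) (prim : is_primitive theta).

(** If [w] occurs in theta^l(a), it occurs in theta^(l+m+k)(a) as soon as theta^(m+k)(a) contains
    [a]; the outermost k iterations can then be split off. *)
Lemma lang_deep w k : lang theta w -> exists u, infix w (iter k (subst_word theta) u).
Proof.
move=> [l [a [l0 wa]]]; have [m m0 allm] := is_primitive_all prim.
exists (subst_iter theta (l + m) a); rewrite -subst_iterD addnC -addnA subst_iterD.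
apply: infix_trans wa _.
have /mem_split [p [s ->]] : a \in subst_iter theta (m + k) a by apply: allm; rewrite leq_addr.
by rewrite -cat1s !iter_subst_word_cat infix_catl // infix_catr // infix_refl.
Qed.

(** Passing from length n to n + 1, every word has at least one extension and the special word has
    #|A|, so the count grows by at least #|A| - 1. *)
Lemma many_words :
  (forall n, exists2 w : seq A, size w = n & forall x, lang theta (rcons w x)) ->
  forall n, exists s : seq (seq A),
    [/\ uniq s, n * #|A|.-1 < size s
      & forall w, w \in s -> size w = n /\ lang theta w].
Proof.
move=> special; elim=> [|n [s [us sz sP]]].
  exists [:: [::]]; split=> // w; rewrite inE => /eqP ->; split=> //.
  have [w' _ Lw'] := special 0.
  have [a _] : exists a : A, a \in A by apply/card_gt0P; apply: ltnW cA.
  exact: lang_infix (infix0s _) (Lw' a).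
have ext (w : seq A) : exists b, lang theta w -> lang theta (rcons w b).
  have [Lw|nL] := pselect (lang theta w).
    by have [b Lb] := lang_extendr cA ne prim Lw; exists b.
  have [a _] : exists a : A, a \in A by apply/card_gt0P; apply: ltnW cA.
  by exists a.
have [f fP] := choice ext; have [wn wnn wnP] := special n.
exists ([seq rcons w (f w) | w <- s & w != wn] ++ [seq rcons wn x | x <- enum A]); split.
- rewrite cat_uniq map_inj_in_uniq ?filter_uniq //; last by move=> ? ? _ _ /rcons_inj [].
  rewrite map_inj_uniq ?enum_uniq ?andbT; last by move=> ? ? /rcons_inj [].
  apply/hasPn => _ /mapP [x _ ->]; apply/mapP => -[w].
  by rewrite mem_filter => /andP [wwn _] /rcons_inj [] E; rewrite E eqxx in wwn.
- have := cA; rewrite size_cat size_map (size_map (rcons wn)) -cardE size_filter.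
  have := count_predC (pred1 wn) s; rewrite count_uniq_mem //.
  have -> : count (predC (pred1 wn)) s = count (fun w => w != wn) s by [].
  move: (count _ _) (#|A|) sz => d c; rewrite mulSn; move: (n * c.-1) => m.
  by case: (wn \in s) => /=; lia.
- move=> w; rewrite mem_cat => /orP [] /mapP [].
    move=> v; rewrite mem_filter => /andP [_ /sP [vn Lv]] ->.
    by rewrite size_rcons vn; split=> //; apply: fP.
  by move=> x _ ->; rewrite size_rcons wnn.
Qed.

End Growth.

(** * Reversal of words and substitutions *)

Section Mirror.
Variable A : finType.
Implicit Types theta : A -> seq A.

Definition mirror theta : A -> seq A := fun a => rev (theta a).

Lemma subst_word_mirror theta w : subst_word (mirror theta) (rev w) = rev (subst_word theta w).
Proof.
elim: w => //= a w IH; rewrite rev_cons -cats1 subst_word_cat IH subst_word1.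
by rewrite -rev_cat.
Qed.

Lemma subst_iter_mirror theta k a : subst_iter (mirror theta) k a = rev (subst_iter theta k a).
Proof. by rewrite /subst_iter; elim: k => //= k ->; rewrite subst_word_mirror. Qed.

Lemma lang_mirror theta w : lang (mirror theta) (rev w) <-> lang theta w.
Proof.
by split=> -[k [a [k0 wa]]]; exists k, a; move: wa; rewrite subst_iter_mirror infix_rev.
Qed.

Lemma is_substitution_mirror theta : is_substitution theta -> is_substitution (mirror theta).
Proof. by move=> ne a; rewrite -size_eq0 size_rev size_eq0. Qed.

Lemma is_primitive_mirror theta : is_primitive theta -> is_primitive (mirror theta).
Proof. by move=> [k k0 kP]; exists k => // a b; rewrite subst_iter_mirror mem_rev. Qed.

End Mirror.

(** * Letter maps that intertwine two substitutions *)

Section Renaming.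
Variables (A B : finType) (pi : A -> B) (theta : A -> seq A) (tau : B -> seq B).
Hypothesis pi_theta : forall a, tau (pi a) = [seq pi x | x <- theta a].

Lemma subst_iter_rename k a : subst_iter tau k (pi a) = [seq pi x | x <- subst_iter theta k a].
Proof.
rewrite /subst_iter; elim: k => //= k ->; elim: (iter _ _ _) => //= b w IH.
by rewrite /subst_word /= map_cat pi_theta -IH.
Qed.

Lemma lang_rename w : lang theta w -> lang tau [seq pi x | x <- w].
Proof.
move=> [k [a [k0 /infixP [p [s E]]]]]; exists k, (pi a); split=> //.
by rewrite subst_iter_rename E !map_cat infix_infix.
Qed.

(** The preimage is cut out of theta^k(a), with pi(a) = b, at the place where [w] stands in
    tau^k(b). *)
Lemma lang_lift w : (forall b, exists a, pi a = b) -> lang tau w ->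
  exists2 u, lang theta u & w = [seq pi x | x <- u].
Proof.
move=> pi_onto [k [b [k0 /infixP [p [s E]]]]]; have [a ab] := pi_onto b.
exists (take (size w) (drop (size p) (subst_iter theta k a))).
  exists k, a; split=> //; apply/infixP.
  exists (take (size p) (subst_iter theta k a)),
    (drop (size w) (drop (size p) (subst_iter theta k a))).
  by rewrite !cat_take_drop.
by rewrite map_take map_drop -subst_iter_rename ab E drop_size_cat // take_size_cat.
Qed.

End Renaming.

(** * Complexity and odd squares of the Fibonacci language *)

Section Fibonacci.
Local Notation o0 := (ord0 : 'I_2).
Local Notation o1 := (ord_max : 'I_2).
Local Notation fibk k := (iter k (subst_word fibonacci)).

Lemma ord2P (x : 'I_2) : x = o0 \/ x = o1.
Proof. by case: x => [[|[|//]] i]; [left|right]; apply: val_inj. Qed.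

(* The longest common prefix of phi^k(01) and phi^k(10). *)
Definition fib_center k := iter k (fun w => subst_word fibonacci w ++ [:: o0]) [::].

(** By induction on [k]: phi preserves comparability of prefixes, and the letter 0 appended to the
    center is matched because phi of each letter begins with 0. *)
Lemma fib_centerP k u :
  prefix (fib_center k) (fibk k u) || prefix (fibk k u) (fib_center k).
Proof.
elim: k => [|k]; first by rewrite prefix0s.
move=> /orP [] /prefixP [r E] /=; apply/orP; last first.
  by right; rewrite E subst_word_cat -catA prefix_prefix.
rewrite E subst_word_cat; case: r {E} => [|x r].
  by right; rewrite cats0 prefix_prefix.
by left; rewrite prefix_catr // eqxx; case: (ord2P x) => -> /=; rewrite ?prefix0s.
Qed.

(** The word phi^k(10) is the center followed by 01 or 10, in alternation. *)
Lemma size_fib_center k :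
  size (fib_center k) + 2 = size (fibk k [:: o0]) + size (fibk k [:: o1]).
Proof.
suff [E | E] : fibk k [:: o1; o0] = fib_center k ++ [:: o0; o1] \/
               fibk k [:: o1; o0] = fib_center k ++ [:: o1; o0].
- by rewrite addnC [RHS]addnC -size_cat -iter_subst_word_cat E size_cat addnC.
- by rewrite addnC [RHS]addnC -size_cat -iter_subst_word_cat E size_cat addnC.
elim: k => [|k [] /= ->]; first by right.
  by right; rewrite subst_word_cat -catA.
by left; rewrite subst_word_cat -catA.
Qed.

(** Windows of length |center| + 1 sorted by their starting point in a block phi^k(0) or phi^k(1).
    By [fib_centerP] the letters seen after that block agree with the center, so there are only
    |phi^k(0)| + |phi^k(1)| = |center| + 2 of them. *)
Definition fib_words k : seq (seq 'I_2) :=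
  [seq take (size (fib_center k)).+1 (drop p (fibk k [:: o0] ++ fib_center k))
    | p <- iota 0 (size (fibk k [:: o0]))] ++
  [seq take (size (fib_center k)).+1 (drop p (fibk k [:: o1] ++ fib_center k))
    | p <- iota 0 (size (fibk k [:: o1]))].

Lemma fib_wordsP k u p : p + (size (fib_center k)).+1 <= size (fibk k u) ->
  take (size (fib_center k)).+1 (drop p (fibk k u)) \in fib_words k.
Proof.
elim: u p => [|x u IH] p; first by rewrite iter_subst_word_nil addnS.
rewrite -cat1s iter_subst_word_cat size_cat => le_p.
have [px|xp] := ltnP p (size (fibk k [:: x])); last first.
  rewrite drop_cat ltnNge xp /=; apply: IH; move: le_p xp.
  by move: (size (iter k _ _)) (size (iter k _ _)) (size (fib_center k)) => a b c; lia.
(* A window that starts inside the first block reads at most |center| letters beyond it. *)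
have -> : take (size (fib_center k)).+1 (drop p (fibk k [:: x] ++ fibk k u)) =
          take (size (fib_center k)).+1 (drop p (fibk k [:: x] ++ fib_center k)).
  have /orP [] := fib_centerP k u => /prefixP [r E]; rewrite E.
    rewrite catA !(drop_cat p (_ ++ fib_center k)) size_cat ltn_addr // takel_cat //.
    by rewrite size_drop size_cat; move: px; move: (size _) (size _) => a b; lia.
  rewrite catA (drop_cat p (_ ++ fibk k u)) size_cat ltn_addr // takel_cat //.
  rewrite -E size_drop size_cat; move: px le_p.
  by move: (size (iter k _ _)) (size (iter k _ _)) (size (fib_center k)) => a b c; lia.
rewrite mem_cat; apply/orP; case: (ord2P x) px => -> px; [left|right].
  by apply/mapP; exists p => //; rewrite mem_iota.
by apply/mapP; exists p => //; rewrite mem_iota.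
Qed.

Lemma fibonacci_is_substitution : is_substitution fibonacci.
Proof. by move=> a; rewrite /fibonacci; case: ifP. Qed.

Lemma fibonacci_is_primitive : is_primitive fibonacci.
Proof. by exists 2 => // a b; case: (ord2P a) => ->; case: (ord2P b) => ->. Qed.

Lemma fib_words_lang k w : lang fibonacci w -> size w = (size (fib_center k)).+1 ->
  w \in fib_words k.
Proof.
move=> /(lang_deep fibonacci_is_primitive k) [u /infixP [p [s E]]] sz.
have -> : w = take (size (fib_center k)).+1 (drop (size p) (fibk k u)).
  by rewrite E drop_size_cat // -sz take_size_cat.
by apply: fib_wordsP; rewrite E !size_cat sz leq_add2l leq_addr.
Qed.

Lemma fib_words_bound k (s : seq (seq 'I_2)) : uniq s ->
  (forall w, w \in s -> size w = (size (fib_center k)).+1 /\ lang fibonacci w) ->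
  size s <= (size (fib_center k)).+2.
Proof.
move=> us sP; have -> : (size (fib_center k)).+2 = size (fib_words k).
  by rewrite size_cat !size_map !size_iota -size_fib_center addn2.
by apply: uniq_leq_size => // w /sP [wn Lw]; apply: fib_words_lang.
Qed.

Lemma size_fib_center_ge k : k <= size (fib_center k).
Proof.
have sw w : size w <= size (subst_word fibonacci w).
  elim: w => //= x w IH; rewrite /subst_word /= size_cat.
  by rewrite -add1n leq_add //; case: (ord2P x) => ->.
by elim: k => //= k IH; rewrite size_cat addn1 ltnS (leq_trans IH).
Qed.

(* Two consecutive lengths |phi^k(0)|, |phi^(k+1)(0)| are never both even. *)
Lemma fib_odd_square r : exists2 u, lang fibonacci (u ++ u) & odd (size u) && (r < size u).
Proof.
have szS k : size (fibk k.+1 [:: o0]) = size (fibk k [:: o0]) + size (fibk k [:: o1]).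
  by rewrite iterSr -size_cat -iter_subst_word_cat.
have sz1 k : size (fibk k.+1 [:: o1]) = size (fibk k [:: o0]) by rewrite iterSr.
have oddk k : odd (size (fibk k [:: o0])) || odd (size (fibk k [:: o1])).
  by elim: k => // k IH; rewrite szS sz1 oddD; case: odd IH; case: odd.
have gek k : k < size (fibk k [:: o0]).
  have := size_fib_center k; have := size_fib_center_ge k.
  elim: k => // k IH _ _; rewrite szS; have := IH (size_fib_center_ge k) (size_fib_center k).
  have : 0 < size (fibk k [:: o1]).
    by rewrite lt0n size_eq0 (iter_subst_word_eq0 fibonacci_is_substitution).
  by lia.
(* The square 00 occurs in phi^3(0) = 01001. *)
have L k : lang fibonacci (fibk k [:: o0] ++ fibk k [:: o0]).
  by rewrite -iter_subst_word_cat; apply: lang_iter; exists 3, o0.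
have [o|e] := boolP (odd (size (fibk r [:: o0]))).
  by exists (fibk r [:: o0]); rewrite ?o ?gek.
exists (fibk r.+1 [:: o0]); rewrite ?(leq_trans _ (gek r.+1)) // andbT szS oddD.
by rewrite (negbTE e); have := oddk r; rewrite (negbTE e).
Qed.

End Fibonacci.

(** * Right special words *)

Section Special.
Variables (A : finType).
Implicit Types (theta : A -> seq A).

(** A finite certificate, decidable by computation, for right special words of every length. *)
Definition right_special theta (a : A) (m k : nat) : bool :=
  [&& 0 < m, 0 < k, 1 < size (subst_iter theta m a), last a (subst_iter theta m a) == a,
      [forall x, head a (subst_iter theta m x) == x]
    & [forall x, infix [:: a; x] (subst_iter theta k a)]].

(** For every letter x the word theta^(nm)(ax) is in the language and consists of theta^(nm)(a)
    followed by a word beginning with x. Hence the last n letters of theta^(nm)(a) extend by every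
    letter. *)
Lemma right_specialP theta a m k : is_substitution theta -> right_special theta a m k ->
  forall n, exists2 w : seq A, size w = n & forall x, lang theta (rcons w x).
Proof.
move=> ne /and5P [m0 k0 sz /eqP lasta /andP [/forallP heads /forallP pairs]] n.
have headk x l : exists t, subst_iter theta (l * m) x = x :: t.
  elim: l => [|l [t E]]; first by exists [::].
  have := heads x; have: subst_iter theta m x != [::] by rewrite iter_subst_word_eq0.
  case Em: (subst_iter theta m x) => [|y t'] //= _ /eqP yx.
  rewrite mulSn addnC subst_iterD Em yx -cat1s iter_subst_word_cat -/(subst_iter _ _ _) E.
  by exists (t ++ iter (l * m) (subst_word theta) t').
(* As theta^m(a) is a non-empty word followed by [a], each further round gains at least one
   letter. *)
have sizek l : l < size (subst_iter theta (l * m) a).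
  elim: l => // l IH; rewrite mulSn addnC subst_iterD.
  case/lastP: (subst_iter theta m a) sz lasta => [|u b] //.
  rewrite size_rcons last_rcons => u0 ->.
  rewrite -cats1 iter_subst_word_cat size_cat -/(subst_iter theta (l * m) a) -add1n.
  apply: leq_add IH; rewrite lt0n size_eq0 iter_subst_word_eq0 //.
  by rewrite -size_eq0 -lt0n.
set v := subst_iter theta (n * m) a.
exists (drop (size v - n) v).
  by rewrite size_drop subKn // ltnW // sizek.
move=> x; have [t E] := headk x n.
have : lang theta (iter (n * m) (subst_word theta) [:: a; x]).
  by apply: lang_iter; exists k, a; split.
apply: lang_infix; rewrite -cat1s iter_subst_word_cat -/(subst_iter _ _ _) -/v.
rewrite -/(subst_iter theta (n * m) x) E.
rewrite -[X in infix _ (X ++ _)](cat_take_drop (size v - n)) -catA -[x :: t]cat1s.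
by rewrite (catA (drop _ _)) cats1 infix_catl // infix_catr // infix_refl.
Qed.

End Special.

(** * Exclusion by word counts and by parity *)

Lemma fibonacci_conjugate_not_many (A : finType) (theta : A -> seq A) :
  2 < #|A| -> in_fibonacci_class theta ->
  ~ forall n, exists s : seq (seq A),
    [/\ uniq s, n * #|A|.-1 < size s
      & forall w, w \in s -> size w = n /\ lang theta w].
Proof.
move=> cA [ne prim _ /(conjugacy_words (ltnW cA) ne prim) [r rP]] many.
(* With n = c + 1 - 2r there are more than 2n words of length n, and they inject into at most c + 2
   Fibonacci words of length c + 1. Since c is at least 4r, 2n is at least c + 2. *)
pose c := size (fib_center (4 * r)).
have cr : 4 * r <= c by apply: size_fib_center_ge.
have [s [us sz /(rP _ _ us) [s' [us' szs' s'P]]]] := many (c.+1 - r.*2).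
have : size s' <= c.+2.
  apply: fib_words_bound us' _ => w /s'P [-> Lw]; split=> //.
  by rewrite subnK //; lia.
rewrite szs' leqNgt => /negP; apply; apply: leq_trans sz.
rewrite ltnS; apply: (@leq_trans ((c.+1 - r.*2) * 2)); first by lia.
by rewrite leq_mul2l; apply/orP; right; move: cA; case: #|_|.
Qed.

Section Exclusion.
Variables (A : finType) (pi : {perm A}) (theta tau : A -> seq A).
Hypotheses (cA : 2 < #|A|) (pi_theta : forall a, tau (pi a) = [seq pi x | x <- theta a]).

Lemma rename_special :
  (forall n, exists2 w : seq A, size w = n & forall x, lang theta (rcons w x)) ->
  forall n, exists2 w : seq A, size w = n & forall x, lang tau (rcons w x).
Proof.
move=> special n; have [w wn wP] := special n.
exists [seq pi x | x <- w] => [|x]; first by rewrite size_map.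
rewrite -(permKV pi x) -map_rcons; by apply: (lang_rename pi_theta).
Qed.

Lemma right_special_not_fibonacci a m k : is_substitution theta ->
  right_special theta a m k -> ~ in_fibonacci_class tau.
Proof.
move=> ne /(right_specialP ne)/rename_special special cl.
apply: (fibonacci_conjugate_not_many cA cl).
by case: cl => ne' prim _ _; apply: many_words special; rewrite // ltnW.
Qed.

(** Reversal turns left special words into right special ones and preserves the number of words of
    each length. *)
Lemma left_special_not_fibonacci a m k : is_substitution theta ->
  right_special (mirror theta) a m k -> ~ in_fibonacci_class tau.
Proof.
move=> ne sp cl.
have special n : exists2 w : seq A, size w = n & forall x, lang (mirror tau) (rcons w x).
  have [w wn wP] := right_specialP (is_substitution_mirror ne) sp n.
  exists [seq pi x | x <- w] => [|x]; first by rewrite size_map.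
  rewrite -(permKV pi x) -map_rcons; apply: (@lang_rename _ _ _ (mirror theta)) (wP _) => b.
  by rewrite /mirror pi_theta map_rev.
apply: (fibonacci_conjugate_not_many cA cl) => n.
case: cl => ne' prim _ _.
have [s [us sz sP]] := many_words (ltnW cA) (is_substitution_mirror ne')
  (is_primitive_mirror prim) special n.
exists [seq rev w | w <- s]; split; rewrite ?map_inj_uniq ?size_map //.
  exact: can_inj revK.
move=> w /mapP [v /sP [vn Lv] ->]; rewrite size_rev; split=> //.
by apply/lang_mirror; rewrite revK.
Qed.

End Exclusion.

(** A square uu with |u| odd and larger than 2r shows the block code the same window at 0 and at
    |u|. The two letters coincide, although [p] changes its value an odd number of times in
    between. *)
Lemma alternating_not_fibonacci (A : finType) (theta : A -> seq A) (p : pred A) :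
  (forall w, lang theta w -> sorted (fun x y => p x != p y) w) ->
  ~ in_fibonacci_class theta.
Proof.
move=> alt [ne prim _ /conjugacy_block_code [phi [r [phiX _ phi_loc]]]].
have [u Lu /andP [oddu ru]] := fib_odd_square r.*2.
have card2 : 1 < #|'I_2| by rewrite card_ord.
have [y Yy yu] := lang_point (- Posz r)%R card2 fibonacci_is_substitution
  fibonacci_is_primitive Lu.
have phiE : phi y (Posz 0) = phi y (Posz (size u)).
  apply: phi_loc => // j jr.
  have Ej l (i : nat) : i < size (u ++ u) -> l = (- Posz r + Posz i)%R ->
      y l = nth ord0 (u ++ u) i.
    by move=> iu ->; rewrite -yu nth_mkseq.
  have uu : absz (j + Posz r)%R < size u by move: (size u) ru => l; lia.
  rewrite (Ej _ (absz (j + Posz r)%R)); last 2 first.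
  - by rewrite size_cat ltn_addr.
  - by lia.
  rewrite (Ej _ (size u + absz (j + Posz r)%R)); last 2 first.
  - by rewrite size_cat ltn_add2l.
  - by move: (size u) => l; lia.
  by rewrite !nth_cat uu ltnNge leq_addr /= addKn.
have pE n : p (phi y (Posz n)) = odd n (+) p (phi y (Posz 0)).
  elim: n => // n IH; rewrite /=; have := alt _ (phiX y Yy (Posz n) 2).
  rewrite /= andbT addr0 IH.
  have -> : (Posz n + 1)%R = Posz n.+1 by lia.
  by case: (odd n); case: (p _); case: (p _).
by have := pE (size u); rewrite -phiE oddu; case: (p _).
Qed.

(** * Conjugacies by recoding *)

(** The hypotheses make the set of admissible two-letter words stable under theta; this restricts
    the pairs that can occur in the language. *)
Lemma lang_sorted (A : finType) (theta : A -> seq A) (e : rel A) :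
  is_substitution theta -> (forall x, sorted e (theta x)) ->
  (forall x y, e x y -> e (last x (theta x)) (head y (theta y))) ->
  forall w, lang theta w -> sorted e w.
Proof.
move=> ne e_in e_cat w [k [a [_ /infixP [p [s E]]]]].
have : sorted e (subst_iter theta k a).
  rewrite /subst_iter; elim: k {E} => //= k; elim: (iter _ _ _) => // x v IH.
  case: v IH => [_ _|y v IH /= /andP [exy pv]]; first by rewrite subst_word1.
  have /= := IH pv; have := e_cat x y exy; have := e_in x.
  rewrite /subst_word /=; case: (theta x) (ne x) => // h t _.
  case: (theta y) (ne y) => //= h' t' _ et exy' pv'.
  by rewrite cat_path et /= exy'.
by rewrite E => /cat_sorted2 [_ /cat_sorted2 []].
Qed.

Section Recoding.
Local Open Scope ring_scope.
Variables (A B : finType) (theta : B -> seq B) (tau : A -> seq A).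
Variables (pi : B -> A) (code : A -> A -> A -> B).
Hypotheses (pi_theta : forall b, tau (pi b) = [seq pi x | x <- theta b])
  (pi_onto : forall a, exists b, pi b = a)
  (codeP : forall x y z, lang theta [:: x; y; z] -> code (pi x) (pi y) (pi z) = y).

(** Applying [pi] letter by letter is a factor map, and [code] inverts it from a letter and its two
    neighbours. *)
Lemma recoding_conjugacy :
  topologically_isomorphic (subst_system theta) (subst_system tau).
Proof.
pose psi (x : biseq B) : biseq A := fun i => pi (x i).
pose phi (y : biseq A) : biseq B := fun i => code (y (i - 1)) (y i) (y (i + 1)).
have Ypsi x : subst_system theta x -> subst_system tau (psi x).
  move=> Xx i n; have -> : subword (psi x) i n = [seq pi b | b <- subword x i n].
    by rewrite /subword /mkseq -map_comp.
  by apply: (lang_rename pi_theta); exact: Xx.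
have phiK x : subst_system theta x -> phi (psi x) = x.
  move=> Xx; apply/funext => i; rewrite /phi; apply: codeP.
  have := Xx (i - 1) 3%N; rewrite /subword /mkseq /= addr0 subrK.
  by have -> : i - 1 + 2%:Z = i + 1 by lia.
have Xphi y : subst_system tau y -> subst_system theta (phi y) /\ psi (phi y) = y.
  (* A window of [y] widened by one letter on both sides lifts to [u]; there [code] recovers [u]
     without its first and last letters, which have only one neighbour. *)
  move=> Yy; have lift i n : exists2 u, lang theta u &
      [seq pi b | b <- u] = subword y (i - 1) n.+2 /\ behead (take n.+1 u) = subword (phi y) i n.
    have [u Lu uE] := lang_lift pi_theta pi_onto (Yy (i - 1) n.+2).
    have szu : size u = n.+2 by rewrite -(size_map pi) -uE size_mkseq.
    exists u => //; split=> //; have b0 : B by case: (u) szu.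
    have yE k : (k < n.+2)%N -> y (i - 1 + k%:Z) = pi (nth b0 u k).
      by move=> kn; rewrite -(nth_map b0 (pi b0)) ?szu // -uE nth_mkseq.
    apply: (@eq_from_nth _ b0) => [|k].
      by rewrite size_behead size_takel ?szu // size_mkseq.
    rewrite size_behead size_takel ?szu //= => kn.
    rewrite nth_behead nth_take // nth_mkseq // /phi.
    have -> : i + k%:Z - 1 = i - 1 + k%:Z by lia.
    have -> : i + k%:Z = i - 1 + k.+1%:Z by lia.
    have -> : i - 1 + k.+1%:Z + 1 = i - 1 + k.+2%:Z by lia.
    rewrite !yE ?codeP //; try lia; apply: lang_infix Lu.
    apply: (@infix_nth _ b0 _ _ k); rewrite ?szu //=; first by lia.
    by case=> [|[|[|//]]] _ /=; rewrite ?addn0 ?addn1 ?addn2.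
  split=> [i n|].
    have [u Lu [_ <-]] := lift i n; apply: lang_infix Lu.
    apply/infixP; exists (take 1 u), (drop n.+1 u).
    by case: (u) => //= ? ?; rewrite take0 /= cat_take_drop.
  apply/funext => i; have [u Lu []] := lift i 1%N; rewrite /psi.
  case: u Lu => [|u0 [|u1 [|u2 [|//]]]] //= _.
  by rewrite /subword /mkseq /= !addr0 subrK => -[_ E _] [E2]; rewrite -E2.
exists psi, phi; split.
- by move=> x Xx; split; [exact: Ypsi | exact: phiK].
- exact: Xphi.
- by apply: continuous_subspaceT; apply: local_continuous => x y i xy; rewrite /psi xy.
- apply: continuous_subspaceT; apply: local_continuous => x y i xy; rewrite /phi.
  by rewrite !xy //; lia.
- by move=> x _; apply/funext.
Qed.

End Recoding.

(** * The Fibonacci language is closed under reversal *)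

Section FibonacciMirror.
Local Notation o0 := (ord0 : 'I_2).
Local Notation o1 := (ord_max : 'I_2).

Lemma fibonacci_conj_mirror w :
  subst_word fibonacci w ++ [:: o0] = o0 :: subst_word (mirror fibonacci) w.
Proof.
by elim: w => // x w IH; rewrite /subst_word /= -catA IH; case: (ord2P x) => ->.
Qed.

(** If v precedes a letter b to its left, the mirror image of phi maps bv to a word containing 0
    followed by the image of v, which is phi(v)0. So the mirror language contains all phi^k(a) by
    induction; the converse follows by reversal. *)
Lemma lang_fibonacci_mirror w : lang (mirror fibonacci) w <-> lang fibonacci w.
Proof.
have ne := is_substitution_mirror fibonacci_is_substitution.
have prim := is_primitive_mirror fibonacci_is_primitive.
have card2 : 1 < #|'I_2| by rewrite card_ord.
have sub v : lang fibonacci v -> lang (mirror fibonacci) v.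
  move=> [k [a [_ va]]]; apply: (lang_infix va) => {va v}.
  elim: k => [|k IH].
    by exists 2, a; case: (ord2P a) => ->.
  have [b Lb] := lang_extendl card2 ne prim IH.
  have := lang_iter 1 Lb; apply: lang_infix => /=.
  rewrite -cat1s subst_word_cat.
  apply: (@infix_trans _ (o0 :: subst_word (mirror fibonacci) (subst_iter fibonacci k a))).
    by rewrite -fibonacci_conj_mirror prefix_infix.
  case: (ord2P b) => ->; last exact: infix_refl.
  exact: (infix_catl [:: o1] (infix_refl _)).
split; last exact: sub.
by rewrite -{1}(revK w) lang_mirror => /sub; rewrite -{1}(revK (rev w)) lang_mirror revK.
Qed.

Lemma subst_system_fibonacci_mirror :
  subst_system (mirror fibonacci) = subst_system fibonacci.
Proof.
by apply/funext => x; apply/propext; split=> Xx i n; apply/lang_fibonacci_mirror; apply: Xx.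
Qed.

End FibonacciMirror.

(** * The substitutions eta and zeta *)

Section EtaZeta.
Local Notation a := letter_a.
Local Notation b := letter_b.
Local Notation c := letter_c.

Lemma ord3P (x : 'I_3) : [\/ x = a, x = b | x = c].
Proof.
by case: x => [[|[|[|//]]] i]; [apply: Or31|apply: Or32|apply: Or33]; apply: val_inj.
Qed.

Lemma forall_ord3 (P : pred 'I_3) : P a -> P b -> P c -> forall x, P x.
Proof. by move=> Pa Pb Pc x; case: (ord3P x) => ->. Qed.

Definition fib_letter (x : 'I_3) : 'I_2 := if x == a then ord_max else ord0.

Lemma fib_letter_onto y : exists x, fib_letter x = y.
Proof. by case: (ord2P y) => ->; [exists b | exists a]. Qed.

Lemma eta_is_substitution : is_substitution subst_eta.
Proof. exact: forall_ord3. Qed.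

Lemma zeta_is_substitution : is_substitution subst_zeta.
Proof. exact: forall_ord3. Qed.

Lemma in_fibonacci_class_eta : in_fibonacci_class subst_eta.
Proof.
split; first exact: eta_is_substitution.
- by exists 6 => // x y; case: (ord3P x) => ->; case: (ord3P y) => ->; vm_compute.
- by move=> x y; case: (ord3P x) => ->; case: (ord3P y) => ->.
(* In words of eta, b comes only after a and c only after b, so the left neighbour tells b from
   c. *)
pose code (x y z : 'I_2) := if y == ord_max then a else if x == ord_max then b else c.
apply: (recoding_conjugacy (pi := fib_letter) (code := code)).
- by move=> x; case: (ord3P x) => ->.
- exact: fib_letter_onto.
pose e x y := (x, y) \in [:: (a, b); (b, a); (c, a); (b, c)].
have e_in x : sorted e (subst_eta x) by case: (ord3P x) => ->.
have e_cat x y : e x y -> e (last x (subst_eta x)) (head y (subst_eta y)).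
  by case: (ord3P x) => ->; case: (ord3P y) => ->.
move=> x y z /(lang_sorted eta_is_substitution e_in e_cat).
by case: (ord3P x) => ->; case: (ord3P y) => ->; case: (ord3P z) => ->.
Qed.

Lemma in_fibonacci_class_zeta : in_fibonacci_class subst_zeta.
Proof.
split; first exact: zeta_is_substitution.
- by exists 6 => // x y; case: (ord3P x) => ->; case: (ord3P y) => ->; vm_compute.
- by move=> x y; case: (ord3P x) => ->; case: (ord3P y) => ->.
(* The letter map [fib_letter] carries zeta to the mirror image of phi. *)
rewrite -subst_system_fibonacci_mirror.
(* In words of zeta, b is followed only by a and c only by b, so the right neighbour decides. *)
pose code (x y z : 'I_2) := if y == ord_max then a else if z == ord_max then b else c.
apply: (recoding_conjugacy (pi := fib_letter) (code := code)).
- by move=> x; case: (ord3P x) => ->.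
- exact: fib_letter_onto.
pose e x y := (x, y) \in [:: (b, a); (a, b); (a, c); (c, b)].
have e_in x : sorted e (subst_zeta x) by case: (ord3P x) => ->.
have e_cat x y : e x y -> e (last x (subst_zeta x)) (head y (subst_zeta y)).
  by case: (ord3P x) => ->; case: (ord3P y) => ->.
move=> x y z /(lang_sorted zeta_is_substitution e_in e_cat).
by case: (ord3P x) => ->; case: (ord3P y) => ->; case: (ord3P z) => ->.
Qed.

(** A renaming fixes a, the only letter with a one-letter image, and hence b, the image of a. But
    eta(b) ends in a while zeta(b) ends in c. *)
Lemma eta_zeta_not_renamed : ~ same_up_to_renaming subst_eta subst_zeta.
Proof.
move=> [pi piP].
have pia : pi a = a.
  by have := congr1 size (piP a); case: (ord3P (pi a)) => ->.
have pib : pi b = b by have := piP a; rewrite pia => -[].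
by have := piP b; rewrite pib => -[] /esym; rewrite /= pia.
Qed.

End EtaZeta.

(** * Incidence matrices *)

Section Eigenvalue.
Local Open Scope ring_scope.
Local Notation a := letter_a.
Local Notation b := letter_b.
Local Notation c := letter_c.


Lemma det_mx33 (R : comNzRingType) (M : 'M[R]_3) :
  \det M = M a a * (M b b * M c c - M b c * M c b)
         - M a b * (M b a * M c c - M b c * M c a)
         + M a c * (M b a * M c b - M b b * M c a).
Proof.
(* Indexing by naturals identifies equal ordinals that carry different proofs, so that [ring] sees
   the same entries. *)
pose m (i j : nat) := M (inord i) (inord j).
have mE i j : M i j = m i j by rewrite /m !inord_val.
rewrite (expand_det_row _ ord0) !big_ord_recl big_ord0 /cofactor.
rewrite !(expand_det_row _ ord0) !big_ord_recl !big_ord0 /cofactor !det_mx11 !mxE.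
rewrite !mE /= /bump /= !add0n; ring.
Qed.

Definition minors3 (R : comNzRingType) (M : 'M[R]_3) : R :=
  M a a * M b b - M a b * M b a + (M a a * M c c - M a c * M c a)
  + (M b b * M c c - M b c * M c b).

Lemma mxtrace33 (R : comNzRingType) (M : 'M[R]_3) : \tr M = M a a + M b b + M c c.
Proof.
pose m (i j : nat) := M (inord i) (inord j).
have mE i j : M i j = m i j by rewrite /m !inord_val.
by rewrite /mxtrace !big_ord_recr big_ord0 /= !mE /= add0r.
Qed.

Lemma eigenvalue33 (F : fieldType) (M : 'M[F]_3) (x : F) :
  eigenvalue M x = (x ^+ 3 + minors3 M * x == \tr M * x ^+ 2 + \det M).
Proof.
have -> : eigenvalue M x = (\det (M - x%:M) == 0).
  apply/eigenvalueP/det0P => -[v].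
    by move=> vM v0; exists v => //; rewrite mulmxBr vM mul_mx_scalar subrr.
  by move=> v0 /eqP; rewrite mulmxBr mul_mx_scalar subr_eq0 => /eqP vM; exists v.
rewrite -[RHS]subr_eq0 -[RHS]oppr_eq0; congr (_ == 0).
rewrite !det_mx33 mxtrace33 /minors3 !mxE /=; ring.
Qed.

Lemma sqr_golden_mean : golden_mean ^+ 2 = golden_mean + 1.
Proof.
have s5 : sqrtC 5%:R ^+ 2 = 5%:R :> algC by rewrite sqrtCK.
rewrite /golden_mean; move: (sqrtC _) s5 => s s5.
have -> : ((1 + s) / 2%:R) ^+ 2 = (1 + s *+ 2 + s ^+ 2) / 4%:R by field.
by rewrite s5; field.
Qed.

Lemma golden_mean_gt1 : 1 < golden_mean.
Proof.
rewrite /golden_mean ltr_pdivlMr ?ltr0n // mul1r (natrD _ 1 1) ltrD2l.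
by rewrite -[X in X < _]sqrtC1 ltr_sqrtC ?nnegrE ?ler0n ?ler01 ?ltr1n.
Qed.

Lemma golden_mean_lt2 : golden_mean < 2%:R.
Proof.
rewrite /golden_mean ltr_pdivrMr ?ltr0n // -natrM (natrD _ 1 3) ltrD2l.
have -> : 3%:R = sqrtC 9%:R :> algC by rewrite (natrX _ 3 2) sqrCK ?ler0n.
by rewrite ltr_sqrtC ?nnegrE ?ler0n ?ltr_nat.
Qed.

(** The exponent of 5 is even on the left and odd on the right. *)
Lemma sqr_eq5 (m n : nat) : (m ^ 2 = 5 * n ^ 2)%N -> n = 0%N.
Proof.
case: (posnP n) => // n0 E; have m0 : (0 < m)%N.
  by rewrite -(ltn_sqr 0) E muln_gt0 expn_gt0 n0.
have := congr1 (logn 5) E; rewrite lognM ?expn_gt0 ?n0 // !lognX => /(congr1 odd).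
by rewrite oddD !oddM.
Qed.

Lemma golden_mean_irrational (p q : int) :
  p%:~R * golden_mean + q%:~R = 0 -> p = 0 /\ q = 0.
Proof.
move=> pq; have E : (q * q + p * q)%:~R = (p * p)%:~R :> algC.
  have qE : q%:~R = - (p%:~R * golden_mean) by apply/eqP; rewrite -addr_eq0 addrC pq.
  rewrite rmorphD !rmorphM /= qE.
  have := sqr_golden_mean; move: golden_mean (p%:~R : algC) => g r gE.
  have -> : - (r * g) * - (r * g) + r * - (r * g) = r ^+ 2 * (g ^+ 2 - g) by ring.
  by rewrite gE; ring.
move/intr_inj: E => E.
have p0 : p = 0.
  (* Completing the square in q^2 + pq = p^2 gives (2q + p)^2 = 5p^2. *)
  have := @sqr_eq5 (absz (2 * q + p)) (absz p).
  have : (absz (2 * q + p)%R ^ 2 = 5 * absz p ^ 2)%N.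
    rewrite !expnS !expn0 !muln1 -!abszM -(abszM 5); congr absz.
    have -> : (2 * q + p) * (2 * q + p) = 4 * (q * q + p * q) + p * p by ring.
    by rewrite E; ring.
  by move=> /[swap] /[apply]; lia.
split=> //; apply/eqP; rewrite -sqrf_eq0; apply/eqP.
by move: E; rewrite p0 !mul0r addr0.
Qed.


Lemma golden_mean_roots (x : algC) :
  (x ^+ 2 == x + 1) = (x == golden_mean) || (x == 1 - golden_mean).
Proof.
rewrite -[LHS]subr_eq0 -[x == golden_mean]subr_eq0 -[x == 1 - _]subr_eq0 -mulf_eq0.
congr (_ == 0); have := sqr_golden_mean; move: golden_mean => g gE.
have -> : (x - g) * (x - (1 - g)) = x ^+ 2 - x + g - g ^+ 2 by ring.
by rewrite gE; ring.
Qed.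

Lemma norm_conj_golden_mean : `|1 - golden_mean| < golden_mean.
Proof.
rewrite distrC ger0_norm ?subr_ge0 ?ltW ?golden_mean_gt1 //.
by rewrite ltrBlDr ltrDl ltr01.
Qed.

(** The characteristic polynomial x^3 - 2x - 1 factors as (x + 1)(x^2 - x - 1). *)
Lemma incidence_golden (theta : 'I_3 -> seq 'I_3) :
  \tr (incidence_mx theta) = 0 -> minors3 (incidence_mx theta) = - 2%:R ->
  \det (incidence_mx theta) = 1 -> is_PF_eigenvalue (incidence_mx theta) golden_mean.
Proof.
move=> tr0 m2 d1.
have eigE x : eigenvalue (incidence_mx theta) x =
    (x == -1) || (x == golden_mean) || (x == 1 - golden_mean).
  rewrite eigenvalue33 tr0 m2 d1 -orbA -golden_mean_roots.
  rewrite -[LHS]subr_eq0 -[x == -1]subr_eq0 -[_ == x + 1]subr_eq0 -mulf_eq0.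
  by congr (_ == 0); ring.
split=> [|mu]; first by rewrite eigE eqxx orbT.
rewrite eigE => /orP [/orP [] /eqP ->|/eqP -> _]; rewrite ?eqxx //.
  by rewrite normrN1 golden_mean_gt1.
exact: norm_conj_golden_mean.
Qed.

(* The third root of the characteristic polynomial is the integer tr - 1. *)
Lemma golden_incidence (theta : 'I_3 -> seq 'I_3) (t m d : int) :
  \tr (incidence_mx theta) = t%:~R -> minors3 (incidence_mx theta) = m%:~R ->
  \det (incidence_mx theta) = d%:~R ->
  is_PF_eigenvalue (incidence_mx theta) golden_mean ->
  [/\ m = t - 2, d = 1 - t & t <= 2].
Proof.
move=> tE mE dE [gold PF].
(* Reducing the characteristic polynomial at the golden mean g by g^2 = g + 1 leaves (2 + m - t)g +
   (1 - t - d), and g is irrational. *)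
have [m2 d1] : 2 + m - t = 0 /\ 1 - t - d = 0.
  apply: golden_mean_irrational; rewrite !(rmorphB, rmorphD) /= .
  move: gold; rewrite eigenvalue33 tE mE dE -subr_eq0 => /eqP <-.
  have := sqr_golden_mean; move: golden_mean => g gE.
  have -> : g ^+ 3 = g * g ^+ 2 by ring.
  rewrite gE; have -> : g * (g + 1) = g ^+ 2 + g by ring.
  by rewrite gE; ring.
have eig : eigenvalue (incidence_mx theta) (t - 1)%:~R.
  rewrite eigenvalue33 tE mE dE.
  have -> : m = t - 2 by lia.
  have -> : d = 1 - t by lia.
  by rewrite !(rmorphB, rmorphD) /=; apply/eqP; ring.
have ne : (t - 1)%:~R != golden_mean.
  apply/eqP => E; have [] := @golden_mean_irrational 1 (1 - t).
    by rewrite -E mul1r -rmorphD /= (_ : t - 1 + (1 - t) = 0) //; lia.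
  by [].
have := lt_trans (PF _ eig ne) golden_mean_lt2.
rewrite -intr_norm (_ : 2%:R = 2%:~R) // ltr_int => t2.
by split; lia.
Qed.

End Eigenvalue.

(** * Classification *)

Section Classification.
Local Notation a := letter_a.
Local Notation b := letter_b.
Local Notation c := letter_c.

(** A set of letters closed under theta would contain all letters of every theta^k(x), hence the
    whole alphabet. *)
Lemma primitive_not_closed (A : finType) (theta : A -> seq A) (P : pred A) x :
  is_primitive theta -> (exists y, ~~ P y) -> P x ->
  exists2 y, P y & ~~ all P (theta y).
Proof.
move=> [k _ prim] [z Pz] Px; apply: contrapT => closed.
have closedP y : P y -> all P (theta y).
  by move=> Py; apply: contraT => nP; case: closed; exists y.
have : all P (subst_iter theta k x).
  rewrite /subst_iter; elim: k {prim} => [|k IH] /=; first by rewrite Px.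
  apply/allP => y /flattenP [_ /mapP [y' y'w ->] yy'].
  exact: (allP (closedP _ (allP IH _ y'w))).
by move=> /allP /(_ z (prim x z)); rewrite (negbTE Pz).
Qed.

(* With aa, ab, ... the entries of a 3x3 matrix, t, m, d its trace, its sum of
   principal 2-minors and its determinant, the first three conditions are
   t <= 2, m = t - 2 and d = 1 - t; the others say that the matrix is
   irreducible. *)
Definition golden_counts (aa ab ac ba bb bc ca cb cc : nat) : bool :=
  [&& aa + bb + cc <= 2,
      aa * bb + aa * cc + bb * cc + 2 ==
        ab * ba + ac * ca + bc * cb + (aa + bb + cc),
      aa * (bb * cc) + (ab * (bc * ca) + ac * (cb * ba)) + (aa + bb + cc) ==
        1 + (aa * (bc * cb) + bb * (ac * ca) + cc * (ab * ba)),
      [&& 0 < ba + ca, 0 < ab + cb & 0 < ac + bc]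
    & [&& 0 < ca + cb, 0 < ba + bc & 0 < ab + ac]].

(** Here [x] is the weight of an edge between two of three vertices. Irreducibility closes it to a
    2-cycle through [y] or to a 3-cycle through [z] and [u], and both cycle weights are at most
    2. *)
Lemma cycle_entry_le2 x y z u :
  x * y <= 2 -> x * (z * u) <= 2 -> 0 < y + z -> 0 < y + u -> x <= 2.
Proof. by case: y z u => [|y] [|z] [|u] //; nia. Qed.

Lemma golden_counts_le2 aa ab ac ba bb bc ca cb cc :
  golden_counts aa ab ac ba bb bc ca cb cc ->
  all (leq^~ 2) [:: aa; ab; ac; ba; bb; bc; ca; cb; cc].
Proof.
case/and5P => t2 /eqP m /eqP d /and3P [ca_ cb_ cc_] /and3P [pab pac pbc].
(* As the trace is at most 2, few diagonals remain, and for each the equations for m and d bound the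
   total weights of the 2-cycles and 3-cycles. *)
have [s2 s3] : ab * ba + ac * ca + bc * cb <= 2 /\
    ab * (bc * ca) + ac * (cb * ba) <= 2.
  by move: aa bb cc t2 m d => [|[|[|?]]] [|[|[|?]]] [|[|[|?]]] //=; nia.
rewrite /= andbT; apply/andP; split; first by lia.
apply/andP; split; first by apply: (@cycle_entry_le2 ab ba ca bc); nia.
apply/andP; split; first by apply: (@cycle_entry_le2 ac ca ba cb); nia.
apply/andP; split; first by apply: (@cycle_entry_le2 ba ab cb ac); nia.
apply/andP; split; first by lia.
apply/andP; split; first by apply: (@cycle_entry_le2 bc cb ab ca); nia.
apply/andP; split; first by apply: (@cycle_entry_le2 ca ac bc ab); nia.
apply/andP; split; first by apply: (@cycle_entry_le2 cb bc ac ba); nia.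
by lia.
Qed.

Lemma golden_counts_columns aa ab ac ba bb bc ca cb cc :
  golden_counts aa ab ac ba bb bc ca cb cc ->
  [&& aa + ba + ca <= 3, ab + bb + cb <= 3 & ac + bc + cc <= 3].
Proof.
move=> counts; have /= := golden_counts_le2 counts; rewrite andbT.
have in3 n : n <= 2 -> n \in iota 0 3 by rewrite mem_iota.
(* Entries at most 2 leave 3^9 matrices to inspect; the column sums are the lengths of the images of
   the letters. *)
have : all (fun aa => all (fun ab => all (fun ac => all (fun ba => all (fun bb =>
    all (fun bc => all (fun ca => all (fun cb => all (fun cc =>
      if golden_counts aa ab ac ba bb bc ca cb cc then
        [&& aa + ba + ca <= 3, ab + bb + cb <= 3 & ac + bc + cc <= 3]
      else true)
    (iota 0 3)) (iota 0 3)) (iota 0 3)) (iota 0 3)) (iota 0 3)) (iota 0 3))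
    (iota 0 3)) (iota 0 3)) (iota 0 3) by vm_compute.
move=> all9; do 8 (case/andP => /in3 /(allP all9) {}all9).
by move=> /in3 /(allP all9); rewrite counts.
Qed.

Definition words3 : seq (seq 'I_3) :=
  let letters := [:: a; b; c] in
  let words2 := [seq [:: x; y] | x <- letters, y <- letters] in
  [seq [:: x] | x <- letters] ++ words2 ++ [seq x :: w | x <- letters, w <- words2].

Lemma mem_words3 w : 0 < size w <= 3 -> w \in words3.
Proof.
case: w => [|x [|y [|z [|]]]] // _; first by case: (ord3P x) => ->.
  by case: (ord3P x) => ->; case: (ord3P y) => ->.
by case: (ord3P x) => ->; case: (ord3P y) => ->; case: (ord3P z) => ->.
Qed.

Definition golden_subst (u v w : seq 'I_3) : bool :=
  [&& golden_counts (count_mem a u) (count_mem a v) (count_mem a w)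
        (count_mem b u) (count_mem b v) (count_mem b w)
        (count_mem c u) (count_mem c v) (count_mem c w),
      u != v, u != w & v != w].

(* The triples are the images of a, b and c; the first two are eta and zeta. *)
Definition candidates : seq (seq 'I_3 * seq 'I_3 * seq 'I_3) :=
  [:: ([:: b], [:: c; a], [:: b; a]); ([:: b], [:: a; c], [:: a; b]);
      ([:: b], [:: c; a], [:: a; b]); ([:: b], [:: a; c], [:: b; a]);
      ([:: b], [:: c; a; a], [:: a]); ([:: b], [:: a; a; c], [:: a]);
      ([:: b], [:: a; c; a], [:: a]);
      ([:: a; b], [:: c], [:: b; a]); ([:: b; a], [:: c], [:: a; b])].

Definition permutations3 : seq ('I_3 * 'I_3 * 'I_3) :=
  [:: (a, b, c); (a, c, b); (b, a, c); (b, c, a); (c, a, b); (c, b, a)].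

Definition apply3 (T : Type) (p : T * T * T) (x : 'I_3) : T :=
  if x == a then p.1.1 else if x == b then p.1.2 else p.2.

(** An exhaustive search over triples of non-empty words of length at most 3; the conditional runs
    the search for a renaming only on triples that pass [golden_subst]. *)
Lemma golden_subst_candidates :
  all (fun u => all (fun v => all (fun w => if golden_subst u v w then
    has (fun s => has (fun p => all (fun x =>
      apply3 (u, v, w) (apply3 p x) == [seq apply3 p y | y <- apply3 s x]) [:: a; b; c])
    permutations3) candidates else true) words3) words3) words3.
Proof. by vm_compute. Qed.

Lemma golden_classification (theta : 'I_3 -> seq 'I_3) :
  is_substitution theta -> is_primitive theta -> injective theta ->
  is_PF_eigenvalue (incidence_mx theta) golden_mean ->
  exists2 s, s \in candidates & same_up_to_renaming (apply3 s) theta.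
Proof.
move=> ne prim inj PF.
pose n x y := count_mem x (theta y).
have counts : golden_counts (n a a) (n a b) (n a c) (n b a) (n b b) (n b c)
   (n c a) (n c b) (n c c).
  pose N x y : int := Posz (n x y).
  have NE x y : incidence_mx theta x y = (N x y)%:~R%R :> algC by rewrite mxE.
  have [] := @golden_incidence theta (N a a + N b b + N c c)%R
    (N a a * N b b - N a b * N b a + (N a a * N c c - N a c * N c a)
      + (N b b * N c c - N b c * N c b))%R
    (N a a * (N b b * N c c - N b c * N c b)
      - N a b * (N b a * N c c - N b c * N c a)
      + N a c * (N b a * N c b - N b b * N c a))%R _ _ _ PF.
  - by rewrite mxtrace33 !NE !(rmorphB, rmorphD, rmorphM).
  - by rewrite /minors3 !NE !(rmorphB, rmorphD, rmorphM).
  - by rewrite det_mx33 !NE !(rmorphB, rmorphD, rmorphM).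
  rewrite /N => mE dE t2.
  (* Primitivity forbids closed sets of one letter, and below of two letters, which gives
     irreducibility. *)
  have open1 x y z : [/\ x != y, x != z & y != z] -> 0 < n y x + n z x.
    move=> [xy xz yz]; have [] := @primitive_not_closed _ theta (pred1 x) x prim.
    - by exists y; rewrite /= eq_sym.
    - exact: eqxx.
    move=> _ /eqP -> /allPn [v vx vx']; rewrite addn_gt0 -!has_count !has_pred1.
    by move: vx vx' xy xz yz; case: (ord3P x) => ->; case: (ord3P y) => ->;
      case: (ord3P z) => ->; case: (ord3P v) => -> //= ->; rewrite ?orbT.
  have open2 x y z : [/\ x != y, x != z & y != z] -> 0 < n z x + n z y.
    move=> [xy xz yz]; have [] := @primitive_not_closed _ theta (pred2 x y) x prim.
    - by exists z; rewrite /= negb_or ![z == _]eq_sym xz.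
    - by rewrite /= eqxx.
    move=> v /orP vxy /allPn [v' vx vx']; rewrite addn_gt0 -!has_count !has_pred1.
    have -> : z = v'.
      by move: vx' xy xz yz; case: (ord3P x) => ->; case: (ord3P y) => ->;
        case: (ord3P z) => ->; case: (ord3P v') => ->.
    by case: vxy vx => /eqP -> ->; rewrite ?orbT.
  apply/and5P; split.
  - by lia.
  - by apply/eqP; nia.
  - by apply/eqP; nia.
  - by rewrite !open1.
  - by rewrite !open2.
have size_n x : size (theta x) = n a x + n b x + n c x.
  rewrite /n; elim: (theta x) => //= y u ->.
  by case: (ord3P y) => -> /=; rewrite ?addSn ?addnS.
have in3 x : theta x \in words3.
  apply: mem_words3; rewrite lt0n size_eq0 ne /= size_n.
  by have /and3P [] := golden_counts_columns counts; case: (ord3P x) => ->.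
have good : golden_subst (theta a) (theta b) (theta c).
  by rewrite /golden_subst counts !(inj_eq inj).
have := golden_subst_candidates.
move=> /allP /(_ _ (in3 a)) /allP /(_ _ (in3 b)) /allP /(_ _ (in3 c)).
rewrite good => /hasP [s sin /hasP [p pin /allP pP]]; exists s => //.
have p_inj : injective (apply3 p).
  have : all (fun p => [&& apply3 p a != apply3 p b, apply3 p a != apply3 p c
    & apply3 p b != apply3 p c]) permutations3 by [].
  move=> /allP /(_ p pin) /and3P [ab ac bc] x y.
  by case: (ord3P x) => ->; case: (ord3P y) => -> // E; move: ab ac bc; rewrite E eqxx.
exists (perm p_inj) => x; rewrite permE.
have -> : [seq perm p_inj y | y <- apply3 s x] = [seq apply3 p y | y <- apply3 s x].
  by apply: eq_map => y; rewrite permE.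
have /pP /eqP <- : x \in [:: a; b; c] by case: (ord3P x) => ->.
by case: (ord3P (apply3 p x)) => ->.
Qed.

(** Quantifiers over letters become explicit lists, so that the certificate computes. In the six
    cases below, up to mirror image, first letters of images form a 3-cycle and the last letter
    returns to a after one or two steps, whence the exponent 6; by exponent 8 all pairs ax have
    occurred. *)
Lemma right_special3 (theta : 'I_3 -> seq 'I_3) :
  [&& 1 < size (subst_iter theta 6 a), last a (subst_iter theta 6 a) == a,
      all (fun x => head a (subst_iter theta 6 x) == x) [:: a; b; c]
    & all (fun x => infix [:: a; x] (subst_iter theta 8 a)) [:: a; b; c]] ->
  right_special theta a 6 8.
Proof.
rewrite /right_special => /and4P [-> -> heads pairs] /=.
have in_abc x : x \in [:: a; b; c] by case: (ord3P x) => ->.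
by apply/andP; split; apply/forallP => x;
  [exact: (allP heads _ (in_abc x)) | exact: (allP pairs _ (in_abc x))].
Qed.

Lemma in_fibonacci_class_candidates (theta : 'I_3 -> seq 'I_3) s :
  s \in candidates -> same_up_to_renaming (apply3 s) theta -> in_fibonacci_class theta ->
  same_up_to_renaming subst_eta theta \/ same_up_to_renaming subst_zeta theta.
Proof.
move=> s_in ren cl; case: (ren) => pi piP.
have card3 : 2 < #|'I_3| by rewrite card_ord.
have not_right : is_substitution (apply3 s) -> right_special (apply3 s) a 6 8 -> False.
  by move=> ne sp; apply: (right_special_not_fibonacci card3 piP ne sp cl).
have not_left : is_substitution (apply3 s) ->
    right_special (mirror (apply3 s)) a 6 8 -> False.
  by move=> ne sp; apply: (left_special_not_fibonacci card3 piP ne sp cl).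
have ne : is_substitution (apply3 s).
  have : all (fun s => all (fun x => apply3 s x != [::]) [:: a; b; c]) candidates by [].
  by move=> /allP /(_ _ s_in) /= /and4P [? ? ? _] x; case: (ord3P x) => ->.
move: s_in; rewrite !inE => /predU1P [E|].
  by left; move: ren; rewrite E.
case/predU1P => [E|].
  by right; move: ren; rewrite E.
case/predU1P => [E|].
  by case: (not_right ne); apply: right_special3; rewrite E; vm_compute.
case/predU1P => [E|].
  by case: (not_left ne); apply: right_special3; rewrite E; vm_compute.
case/predU1P => [E|].
  by case: (not_right ne); apply: right_special3; rewrite E; vm_compute.
case/predU1P => [E|].
  by case: (not_left ne); apply: right_special3; rewrite E; vm_compute.
case/predU1P => [E|].
  (* The image of a is a single other letter, and the images of b and c begin and end with a, so
     alternation of a with other letters is preserved. *)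
  suff alt w : lang theta w -> sorted (fun x y => (x == pi a) != (y == pi a)) w.
    by case: (alternating_not_fibonacci alt cl).
  case: cl => ne' _ _ _; apply: (lang_sorted ne') => [x|x y].
    rewrite -(permKV pi x) piP E.
    by case: (ord3P (pi^-1%g x)) => ->; rewrite /= ?(inj_eq perm_inj).
  rewrite -(permKV pi x) -(permKV pi y) !piP E.
  by case: (ord3P (pi^-1%g x)) => ->; case: (ord3P (pi^-1%g y)) => ->;
    rewrite /= ?(inj_eq perm_inj).
case/predU1P => [E|/eqP E].
  by case: (not_left ne); apply: right_special3; rewrite E; vm_compute.
by case: (not_right ne); apply: right_special3; rewrite E; vm_compute.
Qed.

Lemma incidence_eta_zeta :
  is_PF_eigenvalue (incidence_mx subst_eta) golden_mean /\
  is_PF_eigenvalue (incidence_mx subst_zeta) golden_mean.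
Proof.
split; apply: incidence_golden; rewrite ?mxtrace33 /minors3 ?det_mx33 !mxE /=; ring.
Qed.

End Classification.

Theorem theorem9p1 :
  in_fibonacci_class subst_eta /\
  in_fibonacci_class subst_zeta /\
  is_PF_eigenvalue (incidence_mx subst_eta) golden_mean /\
  is_PF_eigenvalue (incidence_mx subst_zeta) golden_mean /\
  ~ same_up_to_renaming subst_eta subst_zeta /\
  (forall theta : 'I_3 -> seq 'I_3,
     in_fibonacci_class theta ->
     is_PF_eigenvalue (incidence_mx theta) golden_mean ->
     same_up_to_renaming subst_eta theta \/
     same_up_to_renaming subst_zeta theta).
Proof.
have [PFeta PFzeta] := incidence_eta_zeta.
split; first exact: in_fibonacci_class_eta.
split; first exact: in_fibonacci_class_zeta.
split=> //; split=> //; split; first exact: eta_zeta_not_renamed.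
move=> theta cl PF; have [ne prim inj _] := cl.
have [s s_in ren] := golden_classification ne prim inj PF.
exact: in_fibonacci_class_candidates s_in ren cl.
Qed.
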